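(* Let $\mathcal{S}\subset\mathbb{T}^3$ be a piecewise linear unavoidable section, let $\bm{x}_0\in\mathbb{T}^3$, and let $V\subset\mathbb{R}^3$ be a 2-dimensional subspace which contains no rational line and is transverse to $\mathcal{S}$. Then the set $$Y=\{\bm{v}\in V:\ \bm{x}_0+\pi(\bm{v})\in\mathcal{S}\}$$ is a uniformly discrete dense forest in $V\cong\mathbb{R}^2$. Moreover $Y$ is a finite union of cut-and-project sets with associated dimensions $(2,3)$, all having the same physical space $V_{phys}=V$.
   Context: $\mathbb{T}^3=\mathbb{R}^3/\mathbb{Z}^3$, $\pi:\mathbb{R}^3\to\mathbb{T}^3$ the projection. A subspace is rational if it is defined by linear equations with rational coefficients; a rational line is a 1-dimensional rational subspace. A piecewise linear unavoidable section is a set $\mathcal{S}=J_1\cup\dots\cup J_\ell\subset\mathbb{T}^3$, where the $J_i$ are pairwise disjoint images under $\pi$ of closed line segments of finite length in $\mathbb{R}^3$, such that $\mathcal{S}\cap\pi(\bm{x}+Q)\neq\varnothing$ for every $\bm{x}\in\mathbb{R}^3$ and every 2-dimensional rational subspace $Q$. $V$ transverse to $\mathcal{S}$ means that the direction of each of these segments is not contained in $V$. Uniformly discrete: uniform positive lower bound on distances between distinct points. Dense forest in $V$: there is $v$ such that for each $\varepsilon>0$ every line segment in $V$ of length $v(\varepsilon)$ comes within distance $\varepsilon$ of $Y$. A cut-and-project set with associated dimensions $(2,3)$ and physical space $V$: for a decomposition $\mathbb{R}^3=V\oplus V_{int}$ with $\dim V_{int}=1$, projections $\pi_{phys},\pi_{int}$,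 a translated lattice $L\subset\mathbb{R}^3$ and a bounded $W\subset V_{int}$, the set $\pi_{phys}(L\cap\pi_{int}^{-1}(W))$. *)

(* Defs.v *)
From HB Require Import structures.
From mathcomp Require Export all_boot all_order all_algebra.
From mathcomp Require Export generic_quotient ring_quotient.
From mathcomp Require Export all_classical all_reals all_analysis.

Set Implicit Arguments.
Unset Strict Implicit.
Unset Printing Implicit Defensive.

Import Order.TTheory GRing.Theory Num.Theory.
Import numFieldNormedType.Exports.

Local Open Scope classical_set_scope.
Local Open Scope ring_scope.

Section Euclidean.
Context {R : realType} {n : nat}.
Implicit Types (a b : 'rV[R]_n) (V : {vspace 'rV[R]_n}) (Y : set 'rV[R]_n).

(* The norm `|x| of the library on matrices is the sup norm. *)
Definition enorm (x : 'rV[R]_n) : R := Num.sqrt (\sum_(i < n) x 0 i ^+ 2).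

Definition segment a b : set 'rV[R]_n :=
  [set (1 - t) *: a + t *: b | t in `[0, 1]].

Definition uniformly_discrete Y : Prop :=
  exists2 r : R, 0 < r &
    forall x y, Y x -> Y y -> x <> y -> r <= enorm (x - y).

(* Positivity of v matters: for a negative v(eps) there would be no segment of
   that length and the condition would be void. *)
Definition dense_forest V Y : Prop :=
  Y `<=` [set` V] /\
  exists v : R -> R, forall eps : R, 0 < eps ->
    0 < v eps /\
    forall p q, p \in V -> q \in V -> enorm (q - p) = v eps ->
      exists x y, [/\ segment p q x, Y y & enorm (x - y) <= eps].

Definition rational_subspace V : Prop :=
  exists (m : nat) (A : 'M[rat]_(n, m)),
    forall x : 'rV[R]_n, x \in V <-> x *m map_mx ratr A = 0.

Definition contains_no_rational_line V : Prop :=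
  forall D : {vspace 'rV[R]_n},
    \dim D = 1%N -> rational_subspace D -> ~ (D <= V)%VS.

Definition translated_lattice (L : set 'rV[R]_n) : Prop :=
  exists2 B : 'M[R]_n, B \in unitmx &
    exists t : 'rV[R]_n, L = [set t + map_mx intr k *m B | k in [set: 'rV[int]_n]].

End Euclidean.

(* Associated dimensions (d, n) and physical space V. The map [daddv_pi U U'] is
   the projection onto U along U'. *)
Definition cut_and_project_set {R : realType} (d n : nat)
    (V : {vspace 'rV[R]_n}) (Y : set 'rV[R]_n) : Prop :=
  \dim V = d /\
  exists Vint : {vspace 'rV[R]_n},
    [/\ \dim Vint = (n - d)%N, (V + Vint = fullv)%VS, (V :&: Vint = 0)%VS &
      exists (L W : set 'rV[R]_n),
        [/\ translated_lattice L, W `<=` [set` Vint], bounded_set W &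
          Y = daddv_pi V Vint @` (L `&` (daddv_pi Vint V @^-1` W))]].
Arguments cut_and_project_set {R} d n V Y.

Section Torus.
Context (R : realType).

Definition Z3 : {pred 'rV[R]_3} := fun x => x \is a mxOver Num.int.

Lemma Z3_zmod_closed : zmod_closed Z3.
Proof.
split=> [|x y /mxOverP hx /mxOverP hy]; apply/mxOverP => i j.
  by rewrite mxE rpred0.
by rewrite !mxE rpredB.
Qed.

HB.instance Definition _ := GRing.isZmodClosed.Build 'rV[R]_3 Z3 Z3_zmod_closed.

Definition torus : Type := Quotient.quot Z3.

HB.instance Definition _ := GRing.Zmodule.on torus.

Definition torus_proj (x : 'rV[R]_3) : torus := (\pi_torus x)%qT.

Definition unavoidable (S : set torus) : Prop :=
  forall (x : 'rV[R]_3) (Q : {vspace 'rV[R]_3}),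
    \dim Q = 2%N -> rational_subspace Q ->
    S `&` (torus_proj @` [set x + q | q in [set` Q]]) !=set0.

(* J_i is the image of the segment from a i to b i; the segments are part of
   the data, since transversality refers to their directions. *)
Definition pl_unavoidable_section (l : nat) (a b : 'I_l -> 'rV[R]_3)
    (S : set torus) : Prop :=
  let J i := torus_proj @` segment (a i) (b i) in
  [/\ forall i, a i <> b i, trivIset setT J,
      S = \bigcup_i J i & unavoidable S].

Definition transverse (l : nat) (a b : 'I_l -> 'rV[R]_3)
    (V : {vspace 'rV[R]_3}) : Prop :=
  forall i, b i - a i \notin V.

Definition visit_set (S : set torus) (x0 : torus) (V : {vspace 'rV[R]_3}) :
    set 'rV[R]_3 :=
  [set v | v \in V /\ S (x0 + torus_proj v)].

End Torus.

(* Main.v *)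
Require Import Defs.
From mathcomp Require Import ring lra.

(** Each segment, being transverse to V, contributes one cut-and-project set whose
    internal space is the direction of the segment; compactness of the segments
    gives uniform discreteness.

    For the dense forest property, let u be a nonzero vector of V, so that Ru is
    not rational.  Dirichlet's theorem gives arbitrarily small nonzero elements
    of Z^3 modulo Ru, and a limit e of their directions puts the plane Ru + Re
    into the closure of Ru + Z^3.  The values on Z^3 of a functional with kernel
    Ru + Re are either dense, and then this closure is R^3, or integer multiples
    of a constant, and then Ru + Re is rational.  In both cases the closure
    contains a rational plane, all translates of which meet S.  Hence every line
    of direction u comes, within V, arbitrarily close to S, and compactness of
    the set of base points and directions makes the required length uniform. *)

Set Implicit Arguments.
Unset Strict Implicit.
Unset Printing Implicit Defensive.

Import Order.TTheory GRing.Theory Num.Theory.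
Import numFieldNormedType.Exports.

Local Open Scope classical_set_scope.
Local Open Scope ring_scope.

Local Arguments Z3 {R}.

(** * Norms, compactness and hyperplanes in real row vectors *)

Section RowVectors.
Context {R : realType}.

Lemma finite_pos_lower_bound (I : finType) (r : I -> R) :
  (forall i, 0 < r i) -> exists2 rho, 0 < rho & forall i, rho <= r i.
Proof.
(* The default value 1 keeps the minimum positive when [I] is empty. *)
move=> r0; exists (\big[Num.min/1]_i r i); first exact: lt_bigmin.
by move=> i; exact: bigmin_le.
Qed.

Lemma invn_small (eta : R) : 0 < eta ->
  exists N, forall n, (N <= n)%N -> n.+1%:R^-1 <= eta.
Proof.
move=> eta0; exists (Num.trunc eta^-1) => n Nn.
rewrite invf_ple ?posrE ?ltr0n// (le_trans (ltW (truncnS_gt _)))//.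
by rewrite ler_nat.
Qed.

Lemma rV_coord_le n (x : 'rV[R]_n) i : `|x 0 i| <= `|x|.
Proof.
rewrite [leRHS]/Num.norm /= mx_normrE.
exact: (le_bigmax _ (fun ij : 'I_1 * 'I_n => `|x ij.1 ij.2|) (0, i)).
Qed.

Lemma rV_norm_le n (x : 'rV[R]_n) (M : R) :
  0 <= M -> (forall i, `|x 0 i| <= M) -> `|x| <= M.
Proof.
move=> M0 xM; rewrite [leLHS]/Num.norm /= mx_normrE.
by apply: bigmax_le => //= -[i j] _ /=; rewrite ord1.
Qed.

Lemma norm_le_enorm n (x : 'rV[R]_n) : `|x| <= enorm x.
Proof.
apply: rV_norm_le => [|i]; first exact: sqrtr_ge0.
rewrite -sqrtr_sqr ler_sqrt ?sumr_ge0// => [|j _]; last exact: sqr_ge0.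
rewrite (bigD1 i)//= lerDl sumr_ge0// => j _; exact: sqr_ge0.
Qed.

(** The sharp constant is the square root of 3; 2 avoids carrying a root. *)
Lemma enorm_le_norm (x : 'rV[R]_3) : enorm x <= 2 * `|x|.
Proof.
have x0 : 0 <= 2 * `|x| by rewrite mulr_ge0.
rewrite /enorm -[leRHS]ger0_norm// -sqrtr_sqr ler_sqrt ?sqr_ge0//.
rewrite (@le_trans _ _ (\sum_(i < 3) `|x| ^+ 2))//.
  apply: ler_sum => i _; rewrite -(real_normK (num_real (x 0 i))).
  by rewrite lerXn2r ?nnegrE// rV_coord_le.
rewrite sumr_const card_ord exprMn -[leLHS]mulr_natl ler_wpM2r ?sqr_ge0//.
lra.
Qed.

Lemma enormZ n (t : R) (x : 'rV[R]_n) : enorm (t *: x) = `|t| * enorm x.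
Proof.
rewrite /enorm -sqrtr_sqr -sqrtrM ?sqr_ge0// mulr_sumr.
by congr Num.sqrt; apply: eq_bigr => i _; rewrite mxE exprMn.
Qed.

(** Bolzano-Weierstrass, phrased with a cluster point so that no subsequence has to be extracted.
    Every compactness argument below goes through it. *)
Lemma bounded_seq_cluster n (f : nat -> 'rV[R]_n) (M : R) :
  (forall k, `|f k| <= M) ->
  exists2 z : 'rV[R]_n, `|z| <= M &
    forall eta (N : nat), 0 < eta -> exists2 k, (N <= k)%N & `|f k - z| < eta.
Proof.
move=> fM; pose A := [set x : 'rV[R]_n | `|x| <= M].
have clA : closed A.
  have /continuous_closedP : continuous (Num.norm : 'rV[R]_n -> R).
    exact: norm_continuous.
  by move=> /(_ _ (@closed_le R M)).
have bA : bounded_set A.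
  exists M; split=> [|N MN x /= /le_trans]; first exact: num_real.
  by apply; exact: ltW.
have [|z [Az clz]] := @bounded_closed_compact R n A bA clA (f @ \oo) _.
  by exists 0%N => // k _; exact: fM.
exists z => // eta N eta0.
have [|_ [[k Nk <-] zk]] :=
  clz (f @` [set k | (N <= k)%N]) (ball z eta) _ (nbhsx_ballx z eta eta0).
  by exists N => // k Nk; exists k.
exists k => //; move: zk; rewrite -ball_normE /= distrC; exact.
Qed.

Lemma scalar_bound n (phi : {scalar 'rV[R]_n}) :
  exists2 C : R, 0 < C & forall x, `|phi x| <= C * `|x|.
Proof.
exists (1 + \sum_(i < n) `|phi (delta_mx 0 i)|) => [|x].
  by rewrite ltr_pwDl// sumr_ge0.
rewrite {1}(row_sum_delta x) linear_sum mulrDl mul1r mulr_suml.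
apply: (le_trans (ler_norm_sum _ _ _)); rewrite -[leLHS]add0r lerD//.
apply: ler_sum => i _; rewrite linearZ /= normrM mulrC ler_wpM2l//.
exact: rV_coord_le.
Qed.

Lemma exists_notin n (V : {vspace 'rV[R]_n}) :
  (\dim V < n)%N -> exists d, d \notin V.
Proof.
move=> dimV; have /subvPn[d _ dV] : ~~ (fullv <= V)%VS.
  by apply/negP => /dimvS; rewrite dimvf /dim /= mul1n leqNgt dimV.
by exists d.
Qed.

Lemma hyperplane_line_compl n (V : {vspace 'rV[R]_n}) (d : 'rV[R]_n) :
  (\dim V).+1 = n -> d \notin V ->
  [/\ (\dim <[d]> = 1)%N, (V + <[d]> = fullv)%VS & (V :&: <[d]> = 0)%VS].
Proof.
move=> dimV dV; have d0 : d != 0 by apply: contraNneq dV => ->; exact: mem0v.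
have dim1 : \dim <[d]> = 1%N by rewrite dim_vline d0.
have cap0 : (V :&: <[d]> = 0)%VS.
  apply/eqP; rewrite -subv0; apply/subvP => x; rewrite memv_cap memv0.
  move=> /andP[xV /vlineP[t xE]]; move: xV; rewrite xE rpredZeq (negbTE dV) orbF.
  by move=> /eqP->; rewrite scale0r.
split=> //; apply/eqP; rewrite eqEdim subvf /= dimvf dimv_disjoint_sum// dim1.
by rewrite /dim /= mul1n addn1 dimV.
Qed.

(** The functional is the coordinate along [d] in the decomposition of the space into [V] and the
    line of [d]. By the normalisation at [d], subtracting [phi x *: d] brings any [x] into [V]. *)
Lemma hyperplane_scalar n (V : {vspace 'rV[R]_n}) (d : 'rV[R]_n) :
  (\dim V).+1 = n -> d \notin V ->
  exists2 phi : {scalar 'rV[R]_n}, phi d = 1 &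
    forall x, (x \in V) = (phi x == 0).
Proof.
move=> dimV dV; have [_ VD VID] := hyperplane_line_compl dimV dV.
have DIV : (<[d]> :&: V = 0)%VS by rewrite capvC.
have d0 : d != 0 by apply: contraNneq dV => ->; exact: mem0v.
pose phi : {scalar 'rV[R]_n} := (coord [tuple d] ord0 \o daddv_pi <[d]>%VS V).
have phiE t : coord [tuple d] ord0 (t *: d) = t.
  rewrite linearZ /= -[X in coord _ _ X]/([tuple d]`_(ord0 : 'I_1)).
  by rewrite coord_free ?mulr1//; rewrite seq1_free.
have phid : phi d = 1.
  by rewrite /phi /= daddv_pi_id ?memv_line// -[X in coord _ _ X]scale1r phiE.
exists phi => // x.
have xE : x = daddv_pi V <[d]>%VS x + daddv_pi <[d]>%VS V x.
  by rewrite daddv_pi_add// VD memvf.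
have /vlineP[t tE] := memv_pi <[d]>%VS V x.
have -> : phi x = t by rewrite /phi /= tE phiE.
by rewrite xE tE rpredDl ?memv_pi// rpredZeq (negbTE dV) orbF.
Qed.

End RowVectors.

(** * Integer points, Dirichlet approximation and the closure of a line modulo the lattice *)

Section IntegerPoints.
Context {R : realType}.
Implicit Types (x k u : 'rV[R]_3).

Lemma Z3P x : reflect (forall i, x 0 i \is a Num.int) (x \in Z3).
Proof.
apply: (iffP mxOverP) => [xZ i|xZ i j]; first exact: xZ.
by rewrite ord1.
Qed.

Lemma Z3_intr (k : 'rV[int]_3) : (map_mx intr k : 'rV[R]_3) \in Z3.
Proof. by apply/Z3P => i; rewrite mxE intr_int. Qed.

Lemma Z3_map_floor k : k \in Z3 -> k = map_mx intr (map_mx Num.floor k).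
Proof. by move=> /Z3P kZ; apply/rowP => i; rewrite !mxE floorK. Qed.

Lemma Z3_scale_int (c : int) k : k \in Z3 -> c%:~R *: k \in Z3.
Proof. by move=> kZ; rewrite scaler_int rpredMz. Qed.

Lemma Z3_norm_lt1 k : k \in Z3 -> `|k| < 1 -> k = 0.
Proof.
move=> /Z3P kZ k1; apply/rowP => i; rewrite mxE; apply: contraTeq k1 => ki0.
by rewrite -leNgt (le_trans _ (rV_coord_le k i))// norm_intr_ge1.
Qed.

Lemma Z3_reduce x : exists2 k, k \in Z3 & `|x - k| <= 1.
Proof.
exists (map_mx intr (map_mx Num.floor x)); first exact: Z3_intr.
apply: rV_norm_le => // i; rewrite !mxE.
have := floor_itv (x 0 i); rewrite intrD ler_norml; lra.
Qed.

Lemma Z3_closed x :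
  (forall eta, 0 < eta -> exists2 k, k \in Z3 & `|x - k| < eta) -> x \in Z3.
Proof.
move=> xZ; have [k kZ xk] := xZ (1 / 2) ltac:(lra).
rewrite -(subrK k x) rpredD//; have [->|xk0] := eqVneq (x - k) 0; first exact: rpred0.
(* A lattice point strictly closer to [x] than [k] would be at distance less than 1 from [k], hence
   equal to it. *)
have [|h hZ xh] := xZ (Num.min `|x - k| (1 / 2)).
  by rewrite lt_min normr_gt0 xk0; lra.
move: xh; rewrite lt_min => /andP[xh1 xh2].
suff /eqP : h - k = 0 by rewrite subr_eq0 => /eqP hk; rewrite hk ltxx in xh1.
apply: Z3_norm_lt1; first exact: rpredB.
have -> : h - k = (x - k) - (x - h) by apply/rowP => i; rewrite !mxE; ring.
by apply: le_lt_trans (ler_normB _ _) _; lra.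
Qed.

Lemma torus_proj_eqP x y : reflect (torus_proj x = torus_proj y) (x - y \in Z3).
Proof. by rewrite Quotient.idealrBE; exact: eqP. Qed.

Lemma torus_projD x y : torus_proj (x + y) = torus_proj x + torus_proj y.
Proof. exact: Quotient.pi_add. Qed.

Lemma torus_proj_surj (z : torus R) : exists x, z = torus_proj x.
Proof. by exists (repr z); rewrite /torus_proj reprK. Qed.

(** Pigeonhole: the fractional parts of one more than [N.+1 ^ 3] multiples of [x] fall into
    [N.+1 ^ 3] cubes of side [N.+1%:R^-1]. Two multiples in the same cube differ by the required
    [q]. *)
Lemma simultaneous_approximation (x : 'rV[R]_3) (N : nat) :
  exists2 q : nat, (0 < q)%N &
    exists2 k, k \in Z3 & `|q%:R *: x - k| <= N.+1%:R^-1.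
Proof.
pose fr (p : nat) (i : 'I_3) : R := p%:R * x 0 i - (Num.floor (p%:R * x 0 i))%:~R.
have fr01 p i : 0 <= fr p i < 1.
  by rewrite /fr; have := floor_itv (p%:R * x 0 i); rewrite intrD; lra.
have N0 : 0 < N.+1%:R :> R by rewrite ltr0n.
pose f (p : 'I_(N.+1 ^ 3).+1) : {ffun 'I_3 -> 'I_N.+1} :=
  [ffun i => inord (Num.trunc (N.+1%:R * fr p i))].
have truncP p i : (Num.trunc (N.+1%:R * fr p i))%:R <= N.+1%:R * fr p i
    < (Num.trunc (N.+1%:R * fr p i)).+1%:R.
  by apply: truncn_itv; rewrite mulr_ge0//; have /andP[] := fr01 p i.
have truncN p i : (Num.trunc (N.+1%:R * fr p i) < N.+1)%N.
  rewrite -(ltr_nat R); have /andP[/le_lt_trans + _] := truncP p i; apply.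
  by rewrite gtr_pMr//; have /andP[] := fr01 p i.
have /injectivePn[p [q pq fpq]] : ~~ injectiveb f.
  apply/negP => /injectiveP/leq_card.
  by rewrite card_ord card_ffun !card_ord ltnn.
wlog ltpq : p q pq fpq / (p < q)%N.
  move=> H; move: (pq); rewrite neq_ltn => /orP[|] lt; first exact: (H p q).
  by apply: (H q p) => //; rewrite eq_sym.
exists (q - p)%N; first by rewrite subn_gt0.
exists (map_mx intr (\row_i (Num.floor (q%:R * x 0 i) - Num.floor (p%:R * x 0 i)))).
  exact: Z3_intr.
apply: rV_norm_le => [|i]; first by rewrite invr_ge0 ltW.
have -> : ((q - p)%:R *: x - map_mx intr
    (\row_i (Num.floor (q%:R * x 0 i) - Num.floor (p%:R * x 0 i)))) 0 i
    = fr q i - fr p i.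
  by rewrite !mxE natrB ?(ltnW ltpq)// intrB /fr; ring.
have := congr1 (fun g : {ffun 'I_3 -> 'I_N.+1} => nat_of_ord (g i)) fpq.
rewrite !ffunE !inordK// => e.
have := truncP p i; have := truncP q i; rewrite e -![(Num.trunc _).+1%:R]natr1.
move: (Num.trunc _)%:R => m hq hp.
rewrite -(ler_pM2l N0) divff ?gt_eqF// -{1}(gtr0_norm N0) -normrM mulrBr.
by rewrite ler_norml; lra.
Qed.

(** The closure of Ru + Z^3; the lemmas that follow make it a closed subgroup. *)
Definition line_closure u x := forall eta : R, 0 < eta ->
  exists t k, k \in Z3 /\ `|x - t *: u - k| <= eta.

Lemma line_closureB u x y :
  line_closure u x -> line_closure u y -> line_closure u (x - y).
Proof.
move=> xu yu eta eta0; have e2 : 0 < eta / 2 by lra.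
have [s [k [kZ xk]]] := xu _ e2; have [t [h [hZ yh]]] := yu _ e2.
exists (s - t), (k - h); split; first exact: rpredB.
have -> : x - y - (s - t) *: u - (k - h) = (x - s *: u - k) - (y - t *: u - h).
  by apply/rowP => i; rewrite !mxE; ring.
by apply: le_trans (ler_normB _ _) _; lra.
Qed.

Lemma line_closure_Z3 u k : k \in Z3 -> line_closure u k.
Proof.
by move=> kZ eta eta0; exists 0, k; rewrite scale0r subr0 subrr normr0 ltW.
Qed.

Lemma line_closure_line u t : line_closure u (t *: u).
Proof.
move=> eta eta0; exists t, 0; rewrite subr0 subrr normr0 ltW//; split=> //.
exact: rpred0.
Qed.

Lemma line_closureD u x y :
  line_closure u x -> line_closure u y -> line_closure u (x + y).
Proof.
move=> xu yu; rewrite -[y]opprK; apply: line_closureB => //.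
rewrite -sub0r; apply: line_closureB => //.
by rewrite -(scale0r u); exact: line_closure_line.
Qed.

Lemma line_closure_closed u x :
  (forall eta, 0 < eta -> exists2 y, line_closure u y & `|x - y| <= eta) ->
  line_closure u x.
Proof.
move=> xu eta eta0; have e2 : 0 < eta / 2 by lra.
have [y yu xy] := xu _ e2; have [t [k [kZ yk]]] := yu _ e2.
exists t, k; split=> //.
have -> : x - t *: u - k = (x - y) + (y - t *: u - k).
  by apply/rowP => i; rewrite !mxE; ring.
by apply: le_trans (ler_normD _ _) _; lra.
Qed.

Definition irrational_line u := forall k t, k \in Z3 -> k = t *: u -> k = 0.

(** Dirichlet's theorem is applied to [u] rescaled to have [j]-th coordinate 1. The approximation is
    then exact in that coordinate, so the error vector has no [j]-th component and is transverse to
    [u]; irrationality makes it nonzero. *)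
Lemma small_transverse_element u j (eta : R) :
  irrational_line u -> u 0 j != 0 -> 0 < eta ->
  exists g : 'rV[R]_3, [/\ g != 0, g 0 j = 0, `|g| <= eta &
    exists t k, k \in Z3 /\ g = k - t *: u].
Proof.
move=> irru uj eta0.
(* Taking the successor makes [N] positive, so that the error is strictly below 1. *)
have [N0 N0eta] := invn_small eta0; pose N := N0.+1.
have Neta : N.+1%:R^-1 <= eta by exact: N0eta.
have N1 : N.+1%:R^-1 < 1 :> R by rewrite invf_lt1 ?ltr0n// ltr1n.
have [q q0 [k kZ qk]] := simultaneous_approximation ((u 0 j)^-1 *: u) N.
(* The error in coordinate [j] is an integer of absolute value less than 1. *)
have kj : k 0 j = q%:R.
  apply/eqP; rewrite eq_sym -subr_eq0; apply/eqP.
  have qkZ : q%:R - k 0 j \is a Num.int.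
    by rewrite rpredB ?natr_int//; exact/Z3P.
  apply: contraTeq N1 => /(norm_intr_ge1 qkZ) ge1; rewrite -leNgt (le_trans ge1)//.
  apply: le_trans qk; have := rV_coord_le (q%:R *: ((u 0 j)^-1 *: u) - k) j.
  by rewrite !mxE mulVf// mulr1.
exists (k - (q%:R / u 0 j) *: u); split.
- rewrite subr_eq0; apply/eqP => /(irru _ _ kZ) k0.
  by move: kj; rewrite k0 mxE => /esym/eqP; rewrite pnatr_eq0; case: q q0 {qk}.
- by rewrite !mxE kj divfK// subrr.
- by rewrite distrC -scalerA (le_trans qk).
- by exists (q%:R / u 0 j), k.
Qed.

(** The direction [e] is a cluster point of the normalised small elements [g n]. Integer multiples
    of [g n] lie in Ru + Z^3 and are spaced by the small length of [g n], so they come close to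
    every point of the line of [e]. The vanishing [j]-th coordinate survives the limit and keeps [e]
    independent of [u]. *)
Lemma line_closure_second_direction u j :
  irrational_line u -> u 0 j != 0 ->
  exists e : 'rV[R]_3, [/\ e != 0, e 0 j = 0 & forall s : R, line_closure u (s *: e)].
Proof.
move=> irru uj.
have /choice[g gP] : forall n : nat, exists g : 'rV[R]_3, [/\ g != 0, g 0 j = 0,
    `|g| <= n.+1%:R^-1 & exists t k, k \in Z3 /\ g = k - t *: u].
  by move=> n; apply: small_transverse_element => //; rewrite invr_gt0 ltr0n.
pose d n := `|g n|^-1 *: g n.
have g0 n : 0 < `|g n| by rewrite normr_gt0; case: (gP n).
have d1 n : `|d n| = 1.
  by rewrite normrZ ger0_norm ?invr_ge0// mulVf// gt_eqF.
have [|e _ eP] := @bounded_seq_cluster R 3 d 1; first by move=> n; rewrite d1.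
have e_near eta : 0 < eta -> exists n, `|d n - e| < eta.
  by move=> /(eP _ 0%N)[n _ ?]; exists n.
exists e; split.
- apply/eqP => e0; have [n] := e_near 1 ltr01.
  by rewrite e0 subr0 d1 ltxx.
- apply/eqP/negP => /negP ej; have [|n] := e_near `|e 0 j|; first by rewrite normr_gt0.
  apply/negP; rewrite -leNgt distrC (le_trans _ (rV_coord_le _ j))//.
  by rewrite !mxE; have [_ -> _ _] := gP n; rewrite mulr0 subr0.
- move=> s eta eta0; have [|N Neta] := @invn_small R (eta / 2); first by lra.
  have s0 : 0 < `|s| + 1 by rewrite ltr_wpDl.
  have [|n Nn dn] := eP (eta / 2 / (`|s| + 1)) N; first by rewrite !divr_gt0.
  have [_ _ gn [t [k [kZ gE]]]] := gP n.
  (* The multiple [c%:~R *: g n] is within the length of [g n] of [s *: d n]. *)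
  pose c := Num.floor (s / `|g n|).
  exists (- (c%:~R * t)), (c%:~R *: k); split; first exact: Z3_scale_int.
  have -> : s *: e - - (c%:~R * t) *: u - c%:~R *: k
    = s *: (e - d n) + (s / `|g n| - c%:~R) *: g n.
    by rewrite /d; apply/rowP => i; rewrite {3}gE !mxE gE !mxE; ring.
  apply: le_trans (ler_normD _ _) _; rewrite !normrZ.
  have -> : eta = eta / 2 + eta / 2 by lra.
  apply: lerD.
    rewrite distrC; apply: (@le_trans _ _ ((`|s| + 1) * `|d n - e|)).
      by rewrite ler_wpM2r// lerDl.
    by rewrite mulrC -ler_pdivlMr// ltW.
  apply: (@le_trans _ _ (1 * `|g n|)).
    rewrite ler_wpM2r//; have := floor_itv (s / `|g n|).
    by rewrite -/c intrD ler_norml; lra.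
  by rewrite mul1r (le_trans gn)// Neta.
Qed.

End IntegerPoints.

(** * Rational planes and the closure of an irrational line *)

Section RationalPlanes.
Context {R : realType}.
Implicit Types (V Q : {vspace 'rV[R]_3}) (x k u : 'rV[R]_3).

Lemma map_ratr_intr m n (M : 'M[int]_(m, n)) :
  map_mx ratr (map_mx intr M : 'M[rat]_(m, n)) = map_mx intr M :> 'M[R]_(m, n).
Proof. by apply/matrixP => i j; rewrite !mxE ratr_int. Qed.

Lemma no_rational_vector V (r : 'rV[rat]_3) :
  contains_no_rational_line V -> map_mx ratr r \in V -> r = 0.
Proof.
move=> irrV rV; apply/eqP/negP => /negP r0.
have r0' : map_mx ratr r != 0 :> 'rV[R]_3 by rewrite map_mx_eq0.
apply: (irrV <[map_mx ratr r]>%VS); first by rewrite dim_vline r0'.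
  (* The cokernel matrix of [r] supplies rational equations for the line of [r]. *)
  exists 3%N, (cokermx r) => x; rewrite map_cokermx; split.
    by move=> /vlineP[t ->]; rewrite -scalemxAl mulmx_coker scaler0.
  by move=> /eqP; rewrite -submxE => /sub_rVP[t ->]; rewrite memvZ// memv_line.
by rewrite -memvE.
Qed.

Lemma no_integer_vector V k :
  contains_no_rational_line V -> k \in Z3 -> k \in V -> k = 0.
Proof.
move=> irrV /Z3_map_floor kE kV.
have kE' : k = map_mx ratr (map_mx intr (map_mx Num.floor k) : 'rV[rat]_3).
  by rewrite map_ratr_intr.
by rewrite kE' (no_rational_vector irrV (r := map_mx intr _)) ?map_mx0// -kE'.
Qed.

Lemma irrational_line_in V u :
  contains_no_rational_line V -> u \in V -> irrational_line u.
Proof.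
by move=> irrV uV k t kZ kE; apply: (no_integer_vector irrV) => //; rewrite kE memvZ.
Qed.

Lemma integer_plane_vspace (n : 'cV[int]_3) : n != 0 ->
  exists Q, [/\ \dim Q = 2%N, rational_subspace Q &
    forall x, x \in Q <-> x *m map_mx intr n = 0].
Proof.
move=> n0; pose N : 'cV[R]_3 := map_mx intr n.
have N0 : N != 0.
  apply: contra_neq n0 => N0; apply/colP => i; apply/eqP; rewrite mxE.
  rewrite -(intr_eq0 R); have := congr1 (fun M : 'cV[R]_3 => M i 0) N0.
  by rewrite !mxE => ->.
pose f := linfun (mulmxr N : 'rV[R]_3 -> 'M[R]_1).
have QP x : x \in lker f <-> x *m N = 0.
  by rewrite memv_ker lfunE /=; split=> [/eqP|->//].
exists (lker f); split=> //.
- have := limg_ker_dim f fullv; rewrite capfv dimvf /dim /= mul1n => dimE.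
  suff : \dim (limg f) = 1%N by move: dimE => /[swap] ->; rewrite addn1 => -[].
  apply/eqP; rewrite eqn_leq; apply/andP; split.
    by apply: (leq_trans (dimvS (subvf _))); rewrite dimvf.
  rewrite lt0n dimv_eq0; apply: contra N0 => /eqP f0.
  apply/eqP/colP => i; have : f (delta_mx 0 i) \in limg f by rewrite memv_img ?memvf.
  rewrite f0 memv0 lfunE /= -rowE => /eqP/matrixP/(_ 0 0).
  by rewrite !mxE.
- exists 1%N, (map_mx intr n) => x; by rewrite QP map_ratr_intr.
Qed.

(** A single rational equation in three unknowns has a nonzero rational solution, and [V] contains
    no such vector. This gives a direction inside the plane along which one leaves [V]. *)
Lemma integer_plane_not_sub V (n : 'cV[int]_3) : contains_no_rational_line V ->
  exists2 x, x *m map_mx intr n = 0 & x \notin V.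
Proof.
move=> irrV; pose A : 'cV[rat]_3 := map_mx intr n.
have /rowV0Pn[r /sub_kermxP rA r0] : kermx A != 0.
  by rewrite -mxrank_eq0 mxrank_ker -lt0n subn_gt0 (leq_ltn_trans (rank_leq_col _)).
exists (map_mx ratr r); last by apply: contra_neqN r0 => /(no_rational_vector irrV).
have -> : map_mx intr n = map_mx ratr A :> 'cV[R]_3.
  by rewrite map_ratr_intr.
by rewrite -map_mxM rA map_mx0.
Qed.

(** The values of [psi] on Z^3 form a subgroup of the reals, which has arbitrarily small positive
    elements or is cyclic. In the cyclic case the values on the standard basis are integer multiples
    of a generator, and these integers form [n]. *)
Lemma scalar_Z3_dichotomy (psi : {scalar 'rV[R]_3}) d : psi d != 0 ->
  (forall eta, 0 < eta -> exists2 k, k \in Z3 & 0 < psi k < eta) \/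
  exists (g : R) (n : 'cV[int]_3),
    [/\ g != 0, n != 0 & forall x, psi x = g * (x *m map_mx intr n) 0 0].
Proof.
move=> psid; have [|/existsNP[eta /not_implyP[eta0 gap]]] :=
  pselect (forall eta, 0 < eta -> exists2 k, k \in Z3 & 0 < psi k < eta); first by left.
right; pose G := [set psi k | k in [set k | k \in Z3 /\ 0 < psi k]].
have psiE x : psi x = \sum_i x 0 i * psi (delta_mx 0 i).
  by rewrite {1}(row_sum_delta x) linear_sum; apply: eq_bigr => i _; rewrite linearZ.
have dZ i : delta_mx 0 i \in @Z3 R.
  by apply/Z3P => j; rewrite mxE; case: (_ && _).
have [i psii] : exists i, psi (delta_mx 0 i) != 0.
  apply/existsP; apply: contraNT psid; rewrite negb_exists => /forallP psi0.
  by rewrite psiE big1// => i _; move: (psi0 i) => /negbNE/eqP->; rewrite mulr0.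
have infG : has_inf G.
  split; last by exists 0 => _ [k [_ /ltW k0] <-].
  have [pi0|pi0] := ltP 0 (psi (delta_mx 0 i)).
    by exists (psi (delta_mx 0 i)), (delta_mx 0 i).
  exists (psi (- delta_mx 0 i)), (- delta_mx 0 i) => //; split; first exact: rpredNr.
  by rewrite linearN oppr_gt0 lt_neqAle psii.
(* It is enough to be within [eta] of the infimum: a nonzero remainder modulo [psi h] would lie
   between [inf G] and [psi h], and its difference from [psi h] would be a value in the forbidden
   gap. *)
have [g [h [hZ h0] <-] hG] := inf_adherent eta0 infG.
have mult k : k \in Z3 -> psi k = (Num.floor (psi k / psi h))%:~R * psi h.
  move=> kZ; set c := Num.floor _.
  pose r := k - c%:~R *: h.
  have rZ : r \in Z3 by rewrite rpredB// Z3_scale_int.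
  have rE : psi r = psi k - c%:~R * psi h by rewrite /r linearB linearZ.
  have /andP[c1 c2] := floor_itv (psi k / psi h).
  move: c1 c2; rewrite -/c ler_pdivlMr// ltr_pdivrMr// intrD mulrDl mul1r => c1 c2.
  have [r0|r0] := eqVneq (psi r) 0; first by move: r0; rewrite rE; lra.
  exfalso; apply: gap; exists (h - r); first exact: rpredB.
  have rpos : 0 < psi r by rewrite lt_neqAle eq_sym r0 rE; lra.
  have : inf G <= psi r by apply: ge_inf; [case: infG|exists r].
  by rewrite (linearB psi h r) rE /=; lra.
pose n : 'cV[int]_3 := \col_i Num.floor (psi (delta_mx 0 i) / psi h).
have nE x : psi x = psi h * (x *m map_mx intr n) 0 0.
  rewrite psiE mxE mulr_sumr; apply: eq_bigr => j _.
  by rewrite (mult _ (dZ j)) !mxE; ring.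
exists (psi h), n; split=> //; first by rewrite gt_eqF.
by apply: contraNneq psid => n0; rewrite nE n0 map_mx0 mulmx0 mxE mulr0.
Qed.

Lemma line_closure_plane u : u != 0 -> irrational_line u ->
  exists2 n : 'cV[int]_3, n != 0 &
    forall x, x *m map_mx intr n = 0 -> line_closure u x.
Proof.
move=> u0 irru; have [j uj] : exists j, u 0 j != 0 by apply/rV0Pn.
have [e [e0 ej eu]] := line_closure_second_direction irru uj.
pose P := (<[u]> + <[e]>)%VS.
have Pu x : x \in P -> line_closure u x.
  move=> /memv_addP[_ /vlineP[s ->] [_ /vlineP[t ->] ->]].
  by apply: line_closureD => //; exact: line_closure_line.
have dimP : \dim P = 2%N.
  rewrite dimv_disjoint_sum ?dim_vline ?u0 ?e0//.
  apply/eqP; rewrite -subv0; apply/subvP => x; rewrite memv_cap memv0.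
  move=> /andP[/vlineP[s ->] /vlineP[t]] /rowP/(_ j); rewrite !mxE ej mulr0.
  by move=> /eqP; rewrite mulf_eq0 (negbTE uj) orbF => /eqP->; rewrite scale0r.
have [|d dP] := @exists_notin R 3 P; first by rewrite dimP.
have [psi psid psiP] := hyperplane_scalar (congr1 succn dimP) dP.
have [|dense|[g [n [g0 n0 psiE]]]] := @scalar_Z3_dichotomy psi d.
- by rewrite psid oner_eq0.
(* Here the closure is the whole space, so any nonzero normal will do. *)
- exists (delta_mx 0 0); first by apply/cV0Pn; exists 0; rewrite mxE.
  move=> x _; apply: line_closure_closed => eta eta0.
  have d1 : 0 < `|d| + 1 by rewrite ltr_wpDl.
  have [|k kZ /andP[k0 keta]] := dense (eta / (`|d| + 1)); first by rewrite divr_gt0.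
  (* Subtracting a multiple of [k] leaves a height [r] of at most [psi k] above [P]; the short
     correction [r *: d] then leads into [P] + Z^3. *)
  pose c := Num.floor (psi x / psi k); pose r := psi (x - c%:~R *: k).
  have r0 : 0 <= r <= psi k.
    have /andP[c1 c2] := floor_itv (psi x / psi k).
    move: c1 c2; rewrite -/c ler_pdivlMr// ltr_pdivrMr// intrD mulrDl mul1r.
    by rewrite /r linearB linearZ /=; lra.
  exists (x - r *: d).
    rewrite -(subrK (c%:~R *: k) (x - r *: d)); apply: line_closureD.
      apply: Pu; rewrite psiP addrAC (linearB psi _ (r *: d)).
      rewrite [psi (r *: d)]linearZ /= psid mulr1 subrr.
      exact: eqxx.
    by apply: line_closure_Z3; exact: Z3_scale_int.
  rewrite opprB addrCA subrr addr0 normrZ ger0_norm; last by case/andP: r0.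
  move: keta; rewrite ltr_pdivlMr// => /ltW; apply: le_trans.
  apply: ler_pM => //; [by case/andP: r0|by case/andP: r0|by rewrite lerDl].
- exists n => // x xn; apply: Pu; rewrite psiP psiE xn mxE mulr0; exact: eqxx.
Qed.

End RationalPlanes.

(** * The dense forest property *)

Section Forest.
Context {R : realType} {l : nat} {a b : 'I_l -> 'rV[R]_3}.
Implicit Types (S : set (torus R)) (V : {vspace 'rV[R]_3}).
Implicit Types (x z u v w k : 'rV[R]_3).

Lemma pl_sectionP S p : pl_unavoidable_section a b S ->
  S (torus_proj p) <-> exists i (t : R) k,
    [/\ 0 <= t <= 1, k \in Z3 & p = a i + t *: (b i - a i) + k].
Proof.
move=> [_ _ -> _]; split.
  move=> [i _ [_ [t /= t01 <-] /esym/torus_proj_eqP pZ]].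
  exists i, t, (p - ((1 - t) *: a i + t *: b i)); split=> //.
  by apply/rowP => j; rewrite !mxE; ring.
move=> [i [t [k [t01 kZ pE]]]]; exists i => //.
exists ((1 - t) *: a i + t *: b i); first by exists t; rewrite //= in_itv/=.
apply/torus_proj_eqP; rewrite -rpredN.
suff -> : - ((1 - t) *: a i + t *: b i - p) = k by [].
by rewrite pE; apply/rowP => j; rewrite !mxE; ring.
Qed.

(* A rational plane through z in the closure of the line meets S in a point of
   some segment, possibly an endpoint; as this plane is not parallel to V, moving
   slightly inside it reaches a point from which V leads to the interior of the
   segment, and that is an open condition on z and u. *)
Lemma line_near_section S V z u (eps : R) :
  pl_unavoidable_section a b S -> \dim V = 2%N ->
  contains_no_rational_line V -> transverse a b V ->
  u \in V -> u != 0 -> 0 < eps ->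
  exists (T eta : R), 0 < eta /\ forall z' u',
    `|z' - z| <= eta -> `|u' - u| <= eta ->
    exists (t : R) w, [/\ `|t| <= T, w \in V, `|w| <= eps &
      S (torus_proj (z' + t *: u' + w))].
Proof.
move=> hS dimV irrV transV uV u0 eps0.
have [n n0 nu] := line_closure_plane u0 (irrational_line_in irrV uV).
have [Q [dimQ ratQ QP]] := @integer_plane_vspace R n n0.
have [dl0 dl0n dl0V] := @integer_plane_not_sub R V n irrV.
have [y [Sy [_ [q qQ <-] qE]]] :
    S `&` (@torus_proj R @` [set z + q | q in [set` Q]]) !=set0.
  by case: hS => _ _ _; apply.
move: Sy; rewrite -qE => /(pl_sectionP _ hS)[i [sg [k [sg01 kZ zqE]]]] {qE}.
set d := b i - a i in zqE.
have [phi phid phiP] := hyperplane_scalar (congr1 succn dimV) (transV i).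
rewrite -/d in phid.
have phidl : phi dl0 != 0 by rewrite -phiP.
(* With this scaling [dl - d] lies in [V]: a move by [dl] in the rational plane amounts, modulo [V],
   to a move by [d] along the segment. *)
pose dl := (phi dl0)^-1 *: dl0.
have phidl1 : phi dl = 1 by rewrite linearZ /= mulVf.
have [C C0 phiC] := scalar_bound phi.
(* The bound 1/4 lets a shift towards the middle of the segment leave a margin [th1] at both ends;
   the other bound gives the shift at most half of [eps]. *)
pose th1 : R := Num.min (1 / 4) (eps / 2 / (`|dl - d| + 1)).
have dl1 : 0 < `|dl - d| + 1 by rewrite ltr_wpDl.
have th10 : 0 < th1 by rewrite lt_min !divr_gt0.
have th14 : th1 <= 1 / 4 by rewrite ge_min lexx.
have th1e : th1 * `|dl - d| <= eps / 2.
  apply: (@le_trans _ _ (th1 * (`|dl - d| + 1))); first by rewrite ler_wpM2l ?ltW// ltrDl.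
  by rewrite -ler_pdivlMr// ge_min lexx orbT.
have [th [thabs sg1]] : exists th, `|th| = th1 /\ th1 <= sg + th <= 1 - th1.
  have [sg2|sg2] := leP sg (1 / 2).
    by exists th1; rewrite gtr0_norm//; split=> //; lra.
  by exists (- th1); rewrite normrN gtr0_norm//; split=> //; lra.
(* An error [r] of size [rho] moves the parameter by at most the margin [th1], and its correction
   [phi r *: d - r] uses the other half of [eps]. *)
pose rho := Num.min (th1 / C) (eps / 2 / (1 + C * `|d|)).
have Cd : 0 < 1 + C * `|d| by rewrite ltr_pwDl// mulr_ge0// ltW.
have rho0 : 0 < rho by rewrite lt_min !divr_gt0.
have rhoC : C * rho <= th1 by rewrite mulrC -ler_pdivlMr// ge_min lexx.
have rhoe : rho * (1 + C * `|d|) <= eps / 2 by rewrite -ler_pdivlMr// ge_min lexx orbT.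
have qdlu : line_closure u (q + th *: dl).
  apply: nu; rewrite mulmxDl -!scalemxAl dl0n !scaler0 addr0; exact/QP.
(* The error has three sources: this approximation, the change of [z] and the change of [u]. *)
have [|t [m [mZ tm]]] := qdlu (rho / 3); first by lra.
have t1 : 0 < `|t| + 1 by rewrite ltr_wpDl.
exists `|t|, (rho / 3 / (`|t| + 1)); split; first by rewrite !divr_gt0.
move=> z' u' zz' uu'.
have zz : `|z' - z| <= rho / 3.
  apply: (le_trans zz'); rewrite ler_pdivrMr// ler_peMr//; [lra|by rewrite lerDr].
have tuu : `|t| * `|u' - u| <= rho / 3.
  apply: (@le_trans _ _ ((`|t| + 1) * `|u' - u|)); first by rewrite ler_wpM2r// lerDl.
  by rewrite mulrC -ler_pdivlMr.
pose r := (z' - z) + t *: (u' - u) - (q + th *: dl - t *: u - m).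
have rrho : `|r| <= rho.
  apply: (le_trans (ler_normB _ _)); have := ler_normD (z' - z) (t *: (u' - u)).
  by rewrite normrZ; lra.
have phir : `|phi r| <= th1.
  apply: (le_trans (phiC r)); apply: le_trans rhoC; rewrite ler_pM2l//.
(* The point [z' + t *: u'] equals [z + q + th *: dl - m + r]. Adding this vector of [V] replaces
   [th *: dl + r] by [(th + phi r) *: d]. *)
exists t, (phi r *: d - r - th *: (dl - d)); split=> //.
- rewrite memvB ?memvZ// phiP ?(linearB phi _ r) ?(linearB phi dl).
    by rewrite [phi (_ *: d)]linearZ /= phid mulr1 subrr.
  by rewrite phidl1 phid subrr.
- apply: (le_trans (ler_normB _ _)); have := ler_normB (phi r *: d) r.
  rewrite !normrZ thabs.
  have : `|phi r| * `|d| <= C * rho * `|d|.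
    by rewrite ler_wpM2r// (le_trans (phiC r))// ler_pM2l.
  by move: rhoe; rewrite mulrDr mulr1 mulrA [rho * C]mulrC; lra.
apply/(pl_sectionP _ hS); exists i, (sg + th + phi r), (k - m); split.
- by move: phir; rewrite ler_norml; lra.
- exact: rpredB.
have zE : z = a i + sg *: d + k - q by rewrite -zqE addrK.
move: (phi r) => f; rewrite -/d /r zE; apply/rowP => j; rewrite !mxE; ring.
Qed.

(** If no length works for [eps], there are segments of every length [n.+1] far from the visits.
    Their midpoints modulo Z^3 and their directions have a common cluster point, and
    [line_near_section] there contradicts the choice of a long segment. *)
Lemma visit_dense_forest S (x0 : torus R) V :
  pl_unavoidable_section a b S -> \dim V = 2%N ->
  contains_no_rational_line V -> transverse a b V ->
  dense_forest V (visit_set S x0 V).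
Proof.
move=> hS dimV irrV transV; split=> [v []//|].
set Y := visit_set S x0 V.
(* Positivity of [eps] is put under the existential to make the choice total; other values of [eps]
   receive the length 0. *)
suff /choice[v vP] : forall eps : R, exists T : R, 0 < eps -> 0 < T /\
    forall p q, p \in V -> q \in V -> enorm (q - p) = T ->
      exists x y, [/\ segment p q x, Y y & enorm (x - y) <= eps].
  by exists v.
move=> eps; have [eps0|_] := ltP 0 eps; last by exists 0.
apply: contrapT => /forallNP noT.
have /choice[pq pqP] : forall n : nat, exists pq : 'rV[R]_3 * 'rV[R]_3,
    [/\ pq.1 \in V, pq.2 \in V, enorm (pq.2 - pq.1) = n.+1%:R &
      forall x y, segment pq.1 pq.2 x -> Y y -> eps < enorm (x - y)].
  move=> n; apply: contrapT => /forallNP no; apply: (noT n.+1%:R) => _.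
  split=> [|p q pV qV pqn]; first by rewrite ltr0n.
  apply: contrapT => /forallNP noxy; apply: (no (p, q)); split=> // x y xs Yy.
  rewrite ltNge; apply/negP => xy; by apply: (noxy x); exists y.
have [X x0E] := torus_proj_surj x0.
pose mid n := 2^-1 *: ((pq n).1 + (pq n).2).
pose u n := n.+1%:R^-1 *: ((pq n).2 - (pq n).1).
have /choice[k kP] : forall n, exists k, k \in Z3 /\ `|X + mid n - k| <= 1.
  by move=> n; have [k kZ ?] := Z3_reduce (X + mid n); exists k.
pose z n := X + mid n - k n.
have uV n : u n \in V by have [p1 p2 _ _] := pqP n; rewrite memvZ// memvB.
have eu n : enorm (u n) = 1.
  have [_ _ e _] := pqP n; rewrite enormZ e ger0_norm ?invr_ge0//.
  by rewrite mulVf// pnatr_eq0.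
have u1 n : `|u n| <= 1 by rewrite -(eu n) norm_le_enorm.
have u2 n : 1 <= 2 * `|u n| by rewrite -[leLHS](eu n) enorm_le_norm.
(* Base point and direction are joined into one vector so that they cluster along the same
   indices. *)
have [n|zu _ zuP] := @bounded_seq_cluster R (3 + 3) (fun n => row_mx (z n) (u n)) 1.
  apply: rV_norm_le => // i; rewrite mxE; case: (fintype.split i) => j.
    by apply: (le_trans (rV_coord_le _ _)); have [] := kP n.
  exact: (le_trans (rV_coord_le _ _)).
pose zl := lsubmx zu; pose ul := rsubmx zu.
have near (eta : R) (N : nat) : 0 < eta ->
    exists n, [/\ (N <= n)%N, `|z n - zl| <= eta & `|u n - ul| <= eta].
  move=> eta0; have [n Nn /ltW nn] := zuP eta N eta0; exists n; split=> //.
    have -> : z n - zl = lsubmx (row_mx (z n) (u n) - zu).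
      by rewrite linearB /= row_mxKl.
    apply: rV_norm_le => [|j]; first exact: ltW.
    by rewrite mxE (le_trans (rV_coord_le _ _)).
  have -> : u n - ul = rsubmx (row_mx (z n) (u n) - zu).
    by rewrite linearB /= row_mxKr.
  apply: rV_norm_le => [|j]; first exact: ltW.
  by rewrite mxE (le_trans (rV_coord_le _ _)).
have ul0 : ul != 0.
  apply/eqP => ul0; have [|n [_ _]] := near (1 / 4) 0%N; first by lra.
  by rewrite ul0 subr0; have := u2 n; lra.
(* [V] is closed, being the kernel of a bounded functional. *)
have ulV : ul \in V.
  have [|d dV] := @exists_notin R 3 V; first by rewrite dimV.
  have [phi _ phiP] := hyperplane_scalar (congr1 succn dimV) dV.
  have [C C0 phiC] := scalar_bound phi.
  rewrite phiP -normr_le0; apply/ler_addgt0Pl => e e0; rewrite addr0.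
  have [|n [_ _ un]] := near (e / C) 0%N; first by rewrite divr_gt0.
  have -> : phi ul = - phi (u n - ul).
    by have := uV n; rewrite phiP linearB => /eqP ->; rewrite sub0r opprK.
  by rewrite normrN (le_trans (phiC _))// mulrC -ler_pdivlMr.
(* Half of [eps] pays for the factor 2 between the Euclidean and the sup norm. *)
have [|T [eta [eta0 TP]]] :=
  @line_near_section S V zl ul (eps / 2) hS dimV irrV transV ulV ul0.
  by lra.
(* For such [n] the half-length of the segment is at least [T], so a move of at most [T] from the
   midpoint stays on it. *)
have [n [Nn zn un]] := near eta (Num.trunc (2 * T)) eta0.
have [t [w [tT wV weps]]] := TP _ _ zn un.
have [pV qV pqn far] := pqP n.
have n0 : 0 < n.+1%:R :> R by rewrite ltr0n.
pose x := mid n + t *: u n.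
have tn : `|t| <= n.+1%:R / 2.
  apply: (le_trans tT); rewrite ler_pdivlMr// mulrC.
  apply: (le_trans (ltW (truncnS_gt _))).
  by rewrite ler_nat.
have tn' : `|t / n.+1%:R| <= 2^-1.
  by rewrite normrM [ `|_^-1|]ger0_norm ?invr_ge0// ler_pdivrMr// mulrC.
have xs : segment (pq n).1 (pq n).2 x.
  exists (2^-1 + t / n.+1%:R).
    by rewrite /= in_itv /=; move: (t / n.+1%:R) tn' => s; rewrite ler_norml; lra.
  rewrite /x /mid /u; apply/rowP => j; rewrite !mxE; field.
  by rewrite nat1r pnatr_eq0.
move=> Sz; have Yxw : Y (x + w).
  split; first by do 2?apply: memvD => //; apply: memvZ => //; exact: memvD.
  rewrite x0E -torus_projD; move: Sz; congr S.
  apply/torus_proj_eqP; rewrite -rpredN.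
  suff -> : - (z n + t *: u n + w - (X + (x + w))) = k n by have [] := kP n.
  by rewrite /z /x; apply/rowP => j; rewrite !mxE; ring.
have := far _ _ xs Yxw; apply/negP; rewrite -leNgt.
have -> : x - (x + w) = - w by rewrite opprD addrA subrr sub0r.
apply: (le_trans (enorm_le_norm _)); rewrite normrN; lra.
Qed.

End Forest.

(** * Uniform discreteness and the cut-and-project structure *)

Section Discreteness.
Context {R : realType} {l : nat} {a b : 'I_l -> 'rV[R]_3}.
Implicit Types (S : set (torus R)) (V D : {vspace 'rV[R]_3}).
Implicit Types (x v w k : 'rV[R]_3).

(** Without a gap, a cluster point of the parameters gives points of the two segments that differ by
    a limit of lattice points, hence by a lattice point. This contradicts the disjointness of the
    images. *)
Lemma distinct_segments_gap S i j : pl_unavoidable_section a b S -> i != j ->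
  exists2 r : R, 0 < r & forall (s t : R) k, 0 <= s <= 1 -> 0 <= t <= 1 ->
    k \in Z3 -> r <= `|a i + s *: (b i - a i) - (a j + t *: (b j - a j)) + k|.
Proof.
move=> hS ij; set di := b i - a i; set dj := b j - a j.
pose p (s t : R) := a i + s *: di - (a j + t *: dj).
apply: contrapT => no.
have /choice[f fP] : forall n : nat, exists f : R * R * 'rV[R]_3,
    [/\ 0 <= f.1.1 <= 1, 0 <= f.1.2 <= 1, f.2 \in Z3 &
      `|p f.1.1 f.1.2 + f.2| < n.+1%:R^-1].
  move=> n; apply: contrapT => /forallNP nof; apply: no.
  exists n.+1%:R^-1; first by rewrite invr_gt0 ltr0n.
  move=> s t k s01 t01 kZ; rewrite leNgt; apply/negP => h.
  by apply: (nof (s, t, k)).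
(* The parameters are centred so that the norm bound on their limit is
   membership in the unit interval. *)
pose g n : 'rV[R]_2 := \row_c ((if c == 0 then (f n).1.1 else (f n).1.2) *+ 2 - 1).
have [n|q q1 qP] := @bounded_seq_cluster R 2 g 1.
  apply: rV_norm_le => // c; rewrite mxE; have [f1 f2 _ _] := fP n.
  by case: ifP => _; rewrite ler_norml mulr2n; lra.
pose s := (q 0 0 + 1) / 2; pose t := (q 0 1 + 1) / 2.
have s01 : 0 <= s <= 1.
  by have := le_trans (rV_coord_le q 0) q1; rewrite /s ler_norml; lra.
have t01 : 0 <= t <= 1.
  by have := le_trans (rV_coord_le q 1) q1; rewrite /t ler_norml; lra.
have pZ : p s t \in Z3.
  apply: Z3_closed => eta eta0; pose M := `|di| + `|dj| + 1.
  have M0 : 0 < M by rewrite ltr_wpDl// addr_ge0.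
  have [|N NP] := @invn_small R (eta / 2); first by lra.
  have [|n Nn gn] := qP (eta / 2 / M) N; first by rewrite !divr_gt0.
  have [f1 f2 kZ fn] := fP n.
  have gs : `|s - (f n).1.1| <= eta / 2 / M.
    have := le_trans (rV_coord_le (g n - q) 0) (ltW gn).
    by rewrite !mxE /= mulr2n /s !ler_norml; lra.
  have gt : `|t - (f n).1.2| <= eta / 2 / M.
    have := le_trans (rV_coord_le (g n - q) 1) (ltW gn).
    by rewrite !mxE /= mulr2n /t !ler_norml; lra.
  exists (- (f n).2); first by rewrite rpredN.
  have -> : p s t - - (f n).2 = (p (f n).1.1 (f n).1.2 + (f n).2)
      + ((s - (f n).1.1) *: di - (t - (f n).1.2) *: dj).
    by rewrite /p; apply/rowP => c; rewrite !mxE; ring.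
  apply: le_lt_trans (ler_normD _ _) _.
  have := ler_normB ((s - (f n).1.1) *: di) ((t - (f n).1.2) *: dj).
  rewrite !normrZ.
  have h1 := ler_wpM2r (normr_ge0 di) gs; have h2 := ler_wpM2r (normr_ge0 dj) gt.
  have h3 : eta / 2 / M * `|di| + eta / 2 / M * `|dj| <= eta / 2.
    rewrite -mulrDr mulrAC ler_pdivrMr// ler_pM2l; last by lra.
    by rewrite lerDl.
  move: (lt_le_trans fn (NP n Nn)) (le_trans (lerD h1 h2) h3) => fn2 dd2 dd.
  by rewrite (splitr eta) ltr_leD// (le_trans dd).
case: hS => _ /trivIsetP/(_ i j I I ij) triv _ _.
suff : ([set torus_proj x | x in segment (a i) (b i)] `&`
  [set torus_proj x | x in segment (a j) (b j)]) (torus_proj (a i + s *: di)).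
  by rewrite triv.
split.
  exists ((1 - s) *: a i + s *: b i); first by exists s; rewrite //= in_itv/=.
  by congr torus_proj; apply/rowP => c; rewrite !mxE; ring.
exists ((1 - t) *: a j + t *: b j); first by exists t; rewrite //= in_itv/=.
apply/torus_proj_eqP; rewrite -rpredN.
suff -> : - ((1 - t) *: a j + t *: b j - (a i + s *: di)) = p s t by [].
by rewrite /p; apply/rowP => c; rewrite !mxE; ring.
Qed.

(* Bounded vectors of this form involve finitely many k, and k determines the
   vector because d is transverse to V. *)
Lemma same_segment_gap V d : \dim V = 2%N -> d \notin V ->
  exists2 r : R, 0 < r & forall (tau : R) k, `|tau| <= 1 -> k \in Z3 ->
    tau *: d + k \in V -> tau *: d + k != 0 -> r <= `|tau *: d + k|.
Proof.
move=> dimV dV; have [phi phid phiP] := hyperplane_scalar (congr1 succn dimV) dV.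
apply: contrapT => no.
have /choice[f fP] : forall n : nat, exists f : R * 'rV[R]_3,
    [/\ `|f.1| <= 1, f.2 \in Z3, f.1 *: d + f.2 \in V &
      0 < `|f.1 *: d + f.2| < n.+1%:R^-1].
  move=> n; apply: contrapT => /forallNP nof; apply: no.
  exists n.+1%:R^-1; first by rewrite invr_gt0 ltr0n.
  move=> tau k tau1 kZ wV w0; rewrite leNgt; apply/negP => h.
  by apply: (nof (tau, k)); split=> //=; rewrite normr_gt0 w0.
(* Since [phi] vanishes on [V], the lattice vector determines the coefficient of [d]. *)
have fE n : (f n).1 *: d + (f n).2 = (f n).2 - phi (f n).2 *: d.
  have [_ _ + _] := fP n; rewrite phiP linearD linearZ /= phid mulr1.
  by rewrite addr_eq0 => /eqP ->; rewrite scaleNr addrC.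
have [n|k0 _ kP] := @bounded_seq_cluster R 3 (fun n => (f n).2) (1 + `|d|).
  have [tau1 _ _ /andP[_ w1]] := fP n.
  have -> : (f n).2 = ((f n).1 *: d + (f n).2) - (f n).1 *: d.
    by rewrite addrAC subrr add0r.
  apply: (le_trans (ler_normB _ _)); rewrite lerD//.
    by rewrite (le_trans (ltW w1))// invf_le1 ?ltr0n// ler1n.
  by rewrite normrZ ler_piMl.
have [|m _ mk] := kP (1 / 2) 0%N; first by lra.
have [_ mZ _ /andP[w0 _]] := fP m.
(* Beyond [N] the vectors are shorter than the [m]-th one, yet one of them has the same lattice part
   and so equals it. *)
have [N NP] := invn_small w0.
have [|n Nn nk] := kP (1 / 2) N; first by lra.
have [_ nZ _ /andP[_ wn]] := fP n.
have mn : (f n).2 = (f m).2.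
  apply/eqP; rewrite -subr_eq0; apply/eqP/Z3_norm_lt1; first exact: rpredB.
  have -> : (f n).2 - (f m).2 = ((f n).2 - k0) - ((f m).2 - k0).
    by rewrite opprB addrA subrK.
  by apply: le_lt_trans (ler_normB _ _) _; lra.
have := lt_le_trans wn (NP n Nn).
by rewrite !fE mn ltxx.
Qed.

(** The difference of two visits is, modulo Z^3, a difference of points on two segments. Each pair
    of segments has its own gap, and there are finitely many pairs. *)
Lemma visit_uniformly_discrete S (x0 : torus R) V :
  pl_unavoidable_section a b S -> \dim V = 2%N -> transverse a b V ->
  uniformly_discrete (visit_set S x0 V).
Proof.
move=> hS dimV transV.
have /choice[r rP] : forall ij : 'I_l * 'I_l, exists r : R, 0 < r /\
    forall (s t : R) k w, 0 <= s <= 1 -> 0 <= t <= 1 -> k \in Z3 ->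
    w = a ij.1 + s *: (b ij.1 - a ij.1) - (a ij.2 + t *: (b ij.2 - a ij.2)) + k ->
    w \in V -> w != 0 -> r <= `|w|.
  move=> [i j] /=; have [<-|ij] := eqVneq i j.
    have [r r0 rP] := same_segment_gap dimV (transV i).
    exists r; split=> // s t k w s01 t01 kZ wE wV w0.
    have wE' : w = (s - t) *: (b i - a i) + k.
      by rewrite wE; apply/rowP => c; rewrite !mxE; ring.
    rewrite wE' rP -?wE'// ler_norml; lra.
  have [r r0 rP] := distinct_segments_gap hS ij.
  by exists r; split=> // s t k w s01 t01 kZ -> _ _; exact: rP.
have [rho rho0 rhoP] := finite_pos_lower_bound (fun ij => (rP ij).1).
exists rho => // v v' [vV Sv] [v'V Sv'] vv'.
have [X x0E] := torus_proj_surj x0.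
move: Sv Sv'; rewrite x0E -!torus_projD.
move=> /(pl_sectionP _ hS)[i [s [k [s01 kZ vE]]]].
move=> /(pl_sectionP _ hS)[j [t [k' [t01 k'Z v'E]]]].
apply: (le_trans (rhoP (i, j))); apply: le_trans (norm_le_enorm _).
have [_ /(_ s t (k - k'))] := rP (i, j); apply => //=.
- exact: rpredB.
- have -> : v - v' = (X + v) - (X + v') by rewrite opprD addrACA subrr add0r.
  by rewrite vE v'E; apply/rowP => c; rewrite !mxE; ring.
- exact: memvB.
- by rewrite subr_eq0; apply/eqP.
Qed.

Lemma daddv_pi_eq V D v w : (V :&: D = 0)%VS -> v \in V -> w \in D ->
  daddv_pi V D (v + w) = v.
Proof.
move=> VD vV wD; rewrite linearD /= daddv_pi_id//.
have DV : (D :&: V = 0)%VS by rewrite capvC.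
have := daddv_pi_add VD (subvP (addvSr V D) w wD).
rewrite (daddv_pi_id DV wD) => /(congr1 (fun y => y - w)).
by rewrite addrK subrr => ->; rewrite addr0.
Qed.

(** The equation is rewritten as [p - x + k = v - t *: d]. Its left side runs over a translate of
    Z^3, [v] is the physical component and [- t *: d] the internal one, whence the sign in the
    window. *)
Lemma visit_cut_and_project V x (p d : 'rV[R]_3) : \dim V = 2%N -> d \notin V ->
  cut_and_project_set 2 3 V [set v | v \in V /\ exists (t : R) k,
    [/\ 0 <= t <= 1, k \in Z3 & x + v = p + t *: d + k]].
Proof.
move=> dimV dV; split=> //; exists <[d]>%VS.
have [dim1 VD VID] := hyperplane_line_compl (congr1 succn dimV) dV.
have DIV : (<[d]> :&: V = 0)%VS by rewrite capvC.
split=> //.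
exists [set (p - x) + map_mx intr k *m 1%:M | k in [set: 'rV[int]_3]].
exists [set - t *: d | t in `[0, 1]]; split.
- by exists 1%:M; [exact: unitmx1|exists (p - x)].
- by move=> _ [t _ <-] /=; rewrite memvZ// memv_line.
- exists `|d|; split=> [|M dM _ [t /= + <-]]; first exact: num_real.
  rewrite in_itv /= => t01; rewrite normrZ normrN (le_trans _ (ltW dM))//.
  by rewrite ler_piMl// ler_norml; lra.
apply/seteqP; split=> [v [vV [t [k [t01 kZ vE]]]]|_ [y [[k _ <-] [t t01 yE]] <-]].
  have yE : p - x + k = v + - t *: d.
    by apply: (addrI x); rewrite [RHS]addrA vE; apply/rowP => j; rewrite !mxE; ring.
  exists (p - x + k); last by rewrite yE daddv_pi_eq// memvZ// memv_line.
  split.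
    by exists (map_mx Num.floor k) => //; rewrite mulmx1 -Z3_map_floor.
  exists t; first by rewrite /= in_itv.
  by rewrite /= yE addrC daddv_pi_eq// memvZ// memv_line.
split; first exact: memv_pi.
exists t, (map_mx intr k); split; [by move: t01; rewrite /= in_itv|exact: Z3_intr|].
move: t01 yE; rewrite mulmx1; set y1 := p - x + _ => _ yE.
have : daddv_pi V <[d]>%VS y1 + daddv_pi <[d]>%VS V y1 = y1.
  by rewrite daddv_pi_add// VD memvf.
rewrite -yE => /(canRL (addrK _)) ->.
by rewrite /y1; apply/rowP => j; rewrite !mxE; ring.
Qed.

End Discreteness.

Theorem theorem2p5 (R : realType) (l : nat) (a b : 'I_l -> 'rV[R]_3)
    (S : set (torus R)) (x0 : torus R) (V : {vspace 'rV[R]_3})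
    (hS : pl_unavoidable_section a b S)
    (dimV : \dim V = 2%N)
    (irrV : contains_no_rational_line V)
    (transV : transverse a b V) :
  let Y := visit_set S x0 V in
  [/\ uniformly_discrete Y,
      dense_forest V Y &
      exists (m : nat) (C : 'I_m -> set 'rV[R]_3),
        (forall j, cut_and_project_set 2 3 V (C j)) /\ Y = \bigcup_j C j].
Proof.
move=> Y; have [X x0E] := torus_proj_surj x0.
split; [exact: visit_uniformly_discrete hS _ _|exact: visit_dense_forest hS _ _ _|].
exists l, (fun i => [set v | v \in V /\ exists (t : R) k,
  [/\ 0 <= t <= 1, k \in Z3 & X + v = a i + t *: (b i - a i) + k]]); split.
  by move=> i; exact: visit_cut_and_project.
apply/seteqP; split=> [v [vV]|v [i _ [vV [t [k vE]]]]].
  rewrite x0E -torus_projD => /(pl_sectionP _ hS)[i [t [k vE]]].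
  by exists i => //; split=> //; exists t, k.
split=> //; rewrite x0E -torus_projD; apply/(pl_sectionP _ hS).
by exists i, t, k.
Qed.
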